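(* For every periodic (not necessarily purely periodic) sequence $\{r(i)\}$ in $\mathcal{M}_{01}$ with $\{r(i)\}\neq\overline{0}$, there exists exactly one more sequence in $\mathcal{M}_{01}$ (i.e. exactly one sequence in $\mathcal{M}_{01}$ different from $\{r(i)\}$) which is equivalent to $\{r(i)\}$. For every periodic sequence $\{t(i)\}$ in $\mathcal{M}_{10}$, there exists exactly one more sequence in $\mathcal{M}_{10}$ which is equivalent to $\{t(i)\}$.
   Context: All sequences are indexed by $i\ge 1$ and consist of nonnegative integers; $\overline{0}$ is the zero sequence. Two sequences $\{r(i)\}$, $\{r'(i)\}$ are equivalent if there exist integers $k,l$ with $r(k+i)=r'(l+i)$ for all $i\in\mathbb{N}$. A sequence $\{r(i)\}$ is Markoff balanced if (A) $|r(i+1)-r(i)|\le1$ for all $i$, and (B) if $r(i+1)-r(i)$ equals $-1$ (respectively $+1$), then the first of the integers $r(i+j+1)-r(i-j)$, $1\le j<i$, which is not zero is positive (respectively negative). $\mathcal{M}_{01}$ is the family of Markoff balanced sequences satisfying (C$_{01}$): $r(1)\le r(2)$, and if $r(i+1)-r(i)=-1$ then there exists $1\le j<i$ with $r(i+j+1)>r(i-j)$. $\mathcal{M}_{10}$ is the family of Markoff balanced sequences $\{t(i)\}$ satisfying (C$_{10}$): $t(1)\ge t(2)$, and if $t(i+1)-t(i)=+1$ then there exists $1\le j<i$ with $t(i+j+1)<t(i-j)$. *)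

(* Defs.v *)
From mathcomp Require Import all_boot all_order all_algebra.

Set Implicit Arguments.
Unset Strict Implicit.
Unset Printing Implicit Defensive.

Import Order.TTheory GRing.Theory Num.Theory.
Local Open Scope ring_scope.

(* Sequences of nonnegative integers indexed by i >= 1 are functions
   nat -> nat whose value at 0 is junk: it is never inspected below, and
   equality of sequences is seq_eq, not Leibniz equality. *)

Definition seq_eq (r s : nat -> nat) : Prop :=
  forall i : nat, (1 <= i)%N -> r i = s i.

(* The shifts k and l may be taken in nat: a negative one would refer to terms
   of index less than 1. *)
Definition equivalent (r s : nat -> nat) : Prop :=
  exists k l : nat, forall i : nat, (1 <= i)%N -> r (k + i)%N = s (l + i)%N.

(* Periodic from some index on, possibly with a preperiod. *)
Definition periodic (r : nat -> nat) : Prop :=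
  exists p N : nat,
    (0 < p)%N /\ forall i : nat, (N < i)%N -> r (i + p)%N = r i.

Definition step (r : nat -> nat) (i : nat) : int :=
  (r i.+1)%:Z - (r i)%:Z.

(* Used only for 1 <= j < i, where the natural subtraction i - j is exact. *)
Definition mirror_diff (r : nat -> nat) (i j : nat) : int :=
  (r (i + j).+1)%:Z - (r (i - j)%N)%:Z.

(* j is the first index, in the range 1 <= j < i, of a nonzero mirror
   difference around i; there may be none. *)
Definition first_nonzero (r : nat -> nat) (i j : nat) : Prop :=
  [/\ (1 <= j < i)%N, mirror_diff r i j != 0
    & forall m : nat, (1 <= m < j)%N -> mirror_diff r i m = 0].

Definition markoff_balanced (r : nat -> nat) : Prop :=
  (forall i : nat, (1 <= i)%N -> `|step r i| <= 1) /\
  (forall i : nat, (1 <= i)%N ->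
     (step r i = -1 ->
        forall j : nat, first_nonzero r i j -> 0 < mirror_diff r i j) /\
     (step r i = 1 ->
        forall j : nat, first_nonzero r i j -> mirror_diff r i j < 0)).

Definition M01 (r : nat -> nat) : Prop :=
  [/\ markoff_balanced r,
      (r 1 <= r 2)%N
    & forall i : nat, (1 <= i)%N -> step r i = -1 ->
        exists j : nat, (1 <= j < i)%N /\ (r (i - j) < r (i + j).+1)%N].

Definition M10 (t : nat -> nat) : Prop :=
  [/\ markoff_balanced t,
      (t 2 <= t 1)%N
    & forall i : nat, (1 <= i)%N -> step t i = 1 ->
        exists j : nat, (1 <= j < i)%N /\ (t (i + j).+1 < t (i - j))%N].

(* Exactly one sequence of the family M, up to seq_eq, is equivalent to r and
   different from it. *)
Definition exactly_one_more (M : (nat -> nat) -> Prop) (r : nat -> nat) : Prop :=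
  exists s : nat -> nat,
    [/\ M s, ~ seq_eq s r, equivalent s r
      & forall s' : nat -> nat,
          M s' -> ~ seq_eq s' r -> equivalent s' r -> seq_eq s' s].

(* Main.v *)
Require Import Defs.
From mathcomp Require Import all_boot all_order all_algebra.
From mathcomp Require Import zify.

(** Let S n be the sum of the first n terms of a sequence.  Summing the
mirror differences around i gives S (i + j) + S (i - j) - 2 S i, and in these
terms membership in M01 is equivalent to
  S i + S n <= S (i + n) <= S i + S n + 1   for all i and n,
and membership in M10 to the same inequalities for - S.  If the sequence is
eventually periodic with mean P / p in lowest terms, they force
p * S n <= n * P <= p * (S n + 1).  This determines S n except when p divides n,
where two values remain, and the choice made at n = p propagates to all
multiples of p.  So S n is either the floor of n * P / p for all n, or the floor
of (n * P - 1) / p for all n >= 1.  Both choices satisfy the inequalities, and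
as P is invertible modulo p the two sequences are shifts of each other from
some index on. *)

Set Implicit Arguments.
Unset Strict Implicit.
Unset Printing Implicit Defensive.

Import Order.TTheory GRing.Theory Num.Theory.
Local Open Scope ring_scope.

(** * Bends and the mirror condition *)

Definition bend (S : nat -> int) (i j : nat) : int :=
  S (i + j)%N + S (i - j)%N - (S i + S i).

(** For partial sums, mirror differences are the increments of the bends. So the bends keep their
    first value 1 or -1 up to the first nonzero difference, and (B) says that they then move
    inwards. At [j = 1] the premises are vacuous and the bounds express (A). *)
Definition mirrored (S : nat -> int) : Prop :=
  forall i j : nat, (0 < j <= i)%N ->
    ((forall l, (0 < l < j)%N -> bend S i l = 1) -> bend S i j <= 1) /\
    ((forall l, (0 < l < j)%N -> bend S i l = -1) -> -1 <= bend S i j).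

Definition sandwich (S : nat -> int) : Prop :=
  forall i n : nat, S i + S n <= S (i + n)%N <= S i + S n + 1.

Lemma bendN (S : nat -> int) (i j : nat) :
  bend (fun n => - S n) i j = - bend S i j.
Proof. by rewrite /bend; lia. Qed.

Lemma mirroredN (S : nat -> int) :
  mirrored S -> mirrored (fun n => - S n).
Proof.
move=> mS i j ij; have [up dn] := mS i j ij; rewrite bendN.
split=> h.
- suff: -1 <= bend S i j by lia.
  by apply: dn => l /h; rewrite bendN; lia.
- suff: bend S i j <= 1 by lia.
  by apply: up => l /h; rewrite bendN; lia.
Qed.

(* If i is minimal such that the window of length n after i is too light, and
   that window is a palindrome (as far as sums can see), then the mirror
   condition at i and at i + n copies it, letter by letter, all the way back to
   the beginning of the sequence. *)
Lemma bend_propagates (S : nat -> int) (n i : nat) :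
  (0 < n)%N -> mirrored S ->
  (forall k, (0 < k < n)%N -> S (i + n)%N + S i = S (i + k)%N + S (i + (n - k))%N) ->
  (forall t, (t < i)%N -> S t + S (i + n)%N + 1 <= S (t + n)%N + S i) ->
  forall j, (0 < j <= i)%N ->
    bend S i j = -1 /\
    ((n <= j)%N -> S (i - j + n)%N + S i = S (i - j)%N + S (i + n)%N + 1).
Proof.
move=> n0 mS split_n above; elim/ltn_ind=> j IH ij.
have [_ dn] := mS i j ij.
have {dn} : -1 <= bend S i j.
  by apply: dn => l lj; have [] := IH l ltac:(lia) ltac:(lia).
have := above (i - j)%N ltac:(lia).
have [jn|nj] := ltnP j n.
  have := split_n j ltac:(lia).
  have -> : (i - j + n = i + (n - j))%N by lia.
  by rewrite /bend; split; lia.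
have [jn|{}nj] := leqP j n.
  have -> : j = n by lia.
  have -> : (i - n + n = i)%N by lia.
  by rewrite /bend; split; lia.
(* Reflecting at [e] bounds S (i + j); with [above] at i - l and at i - j this gives bend S i j <=
   -1. As -1 is also a lower bound, every inequality used is an equality, whence both claims. *)
pose l := (j - n)%N; pose e := (i + n)%N.
have [up _] := mS e l ltac:(lia).
have {up} : bend S e l <= 1.
  apply: up => m ml; have [bm] := IH (n + m)%N ltac:(lia) ltac:(lia).
  move=> /(_ ltac:(lia)).
  have [bm' tm] := IH m ltac:(lia) ltac:(lia).
  have -> : (i - (n + m) + n = i - m)%N by lia.
  move: bm bm'; rewrite /bend /e.
  have -> : (i + (n + m) = i + n + m)%N by lia.
  have [mn|nm] := ltnP m n.
    have := split_n m ltac:(lia).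
    have -> : (i + n - m = i + (n - m))%N by lia.
    by lia.
  have := tm nm.
  have -> : (i - m + n = i + n - m)%N by lia.
  by lia.
have := above (i - l)%N ltac:(lia).
rewrite /bend /e.
have -> : (i + n + l = i + j)%N by lia.
have -> : (i - l + n = i + n - l)%N by lia.
have -> : (i - j + n = i - l)%N by lia.
by split; lia.
Qed.

(** Take a violation with n, then i, minimal. The bounds for shorter windows must then all be tight,
    which makes the window a palindrome, so [bend_propagates] applies. For a light window its
    conclusion contradicts the last hypothesis. *)
Lemma mirrored_sandwich (S : nat -> int) :
  S 0%N = 0 -> mirrored S ->
  (forall i, (0 < i)%N -> ~ forall j, (0 < j <= i)%N -> bend S i j = -1) ->
  sandwich S.
Proof.
move=> S0 mS esc i n; elim/ltn_ind: n i => n IH.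
have [->|n0] := posnP n; first by move=> i; rewrite addn0 S0; lia.
have low : forall i, S i + S n <= S (i + n)%N.
  elim/ltn_ind=> i IHi; rewrite leNgt; apply/negP => viol.
  have i0 : (0 < i)%N by case: (posnP i) viol => // ->; rewrite S0 add0n; lia.
  have splits k : (0 < k < n)%N ->
    [/\ S (i + k)%N = S i + S k, S n = S k + S (n - k)%N + 1 &
        S (i + n)%N = S i + S n - 1].
    move=> kn; have /andP[a1 _] := IH k ltac:(lia) i.
    have := IH (n - k)%N ltac:(lia) (i + k)%N.
    have := IH (n - k)%N ltac:(lia) k.
    have -> : (i + k + (n - k) = i + n)%N by lia.
    have -> : (k + (n - k) = n)%N by lia.
    by move=> /andP[_ a2] /andP[a3 _]; split; lia.
  have top : S (i + n)%N = S i + S n - 1.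
    (* A window of length 1 cannot be split; it is compared with the term before it. *)
    have [n1|n1] := leqP n 1; last by have [] := splits 1%N ltac:(lia).
    have := IHi (i - 1)%N ltac:(lia).
    have [_ /(_ _)] := mS i 1%N ltac:(lia); rewrite /bend.
    have -> : n = 1%N by lia.
    have -> : (i - 1 + 1 = i)%N by lia.
    move=> /(_ _) h; have {h} := h ltac:(lia); move: viol.
    have -> : n = 1%N by lia.
    by lia.
  apply: (esc i i0) => j ij.
  apply: (proj1 (bend_propagates n0 mS _ _ ij)) => [k kn|t ti].
    have [a1 a2 _] := splits k kn.
    have [a3 _ _] := splits (n - k)%N ltac:(lia).
    by lia.
  by have := IHi t ti; lia.
suff high : forall i, S (i + n)%N <= S i + S n + 1 by move=> i; rewrite low high.
elim/ltn_ind=> i IHi; rewrite leNgt; apply/negP => viol.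
have i0 : (0 < i)%N by case: (posnP i) viol => // ->; rewrite S0 add0n; lia.
have splits k : (0 < k < n)%N ->
  [/\ S (i + k)%N = S i + S k + 1, S n = S k + S (n - k)%N &
      S (i + n)%N = S i + S n + 2].
  move=> kn; have /andP[_ a1] := IH k ltac:(lia) i.
  have := IH (n - k)%N ltac:(lia) (i + k)%N.
  have := IH (n - k)%N ltac:(lia) k.
  have -> : (i + k + (n - k) = i + n)%N by lia.
  have -> : (k + (n - k) = n)%N by lia.
  by move=> /andP[a2 _] /andP[_ a3]; split; lia.
have top : S (i + n)%N = S i + S n + 2.
  have [n1|n1] := leqP n 1; last by have [] := splits 1%N ltac:(lia).
  have := IHi (i - 1)%N ltac:(lia).
  have [h _] := mS i 1%N ltac:(lia); have {h} := h ltac:(lia).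
  rewrite /bend; move: viol.
  have -> : n = 1%N by lia.
  have -> : (i - 1 + 1 = i)%N by lia.
  by lia.
(* For i < n, splitting at n - i and at i gives two different values of S n. *)
have [lt_in|le_ni] := ltnP i n.
  have [a1 _ _] := splits (n - i)%N ltac:(lia).
  have [_ a2 _] := splits i ltac:(lia).
  move: a1; have -> : (i + (n - i) = n)%N by lia.
  by lia.
(* The window after i is too heavy: now the propagation makes the prefix of
   length n itself one unit heavier than S n. *)
have [] := @bend_propagates (fun m => - S m) n i n0 (mirroredN mS) _ _ i ltac:(lia).
- move=> k kn; have [a1 a2 _] := splits k kn.
  have [a3 _ _] := splits (n - k)%N ltac:(lia).
  by lia.
- by move=> t ti; have := IHi t ti; lia.
- move=> _ /(_ le_ni); rewrite subnn add0n S0; have := low 0%N.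
  by rewrite add0n S0; lia.
Qed.

(** * Membership in the families through partial sums *)

Definition psum (r : nat -> nat) (n : nat) : int := (\sum_(0 <= i < n) r i.+1)%N%:Z.

Lemma psum0 (r : nat -> nat) : psum r 0 = 0.
Proof. by rewrite /psum big_nil. Qed.

Lemma psumS (r : nat -> nat) (n : nat) : psum r n.+1 = psum r n + (r n.+1)%:Z.
Proof. by rewrite /psum big_nat_recr. Qed.

Lemma stepE (r : nat -> nat) (i : nat) :
  (0 < i)%N -> step r i = bend (psum r) i 1.
Proof.
case: i => // i _; rewrite /step /bend addn1 subn1 /= 2!psumS; lia.
Qed.

Lemma mirror_diffE (r : nat -> nat) (i j : nat) : (j < i)%N ->
  mirror_diff r i j = bend (psum r) i j.+1 - bend (psum r) i j.
Proof.
move=> ji; rewrite /mirror_diff /bend addnS psumS.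
have -> : (i - j = (i - j.+1).+1)%N by lia.
by rewrite psumS; lia.
Qed.

Lemma balanced_mirrored (r : nat -> nat) :
  markoff_balanced r -> mirrored (psum r).
Proof.
move=> [A B] i [//|[|j]] ij.
  by have := A i ltac:(lia); rewrite stepE; lia.
have [dn up] := B i ltac:(lia).
split=> h; have b1 := h 1%N ltac:(lia); have bj := h j.+1 ltac:(lia).
all: rewrite leNgt; apply/negP => viol.
all: have md l : (0 < l < j.+1)%N -> mirror_diff r i l = 0.
1,3: by move=> lj; rewrite mirror_diffE ?(h l) ?(h l.+1); lia.
all: have first : first_nonzero r i j.+1.
1,3: by split=> //; rewrite ?mirror_diffE; lia.
- by have := up ltac:(rewrite stepE; lia) _ first; rewrite mirror_diffE; lia.
- by have := dn ltac:(rewrite stepE; lia) _ first; rewrite mirror_diffE; lia.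
Qed.

Lemma sandwich_bend (S : nat -> int) (i j : nat) :
  sandwich S -> (j <= i)%N -> -1 <= bend S i j <= 1.
Proof.
move=> sw ji; have := sw i j; have := sw (i - j)%N j.
by rewrite subnK // /bend; lia.
Qed.

Lemma sandwichN_bend (S : nat -> int) (i j : nat) :
  sandwich (fun n => - S n) -> (j <= i)%N -> -1 <= bend S i j <= 1.
Proof. by move=> sw /(sandwich_bend sw); rewrite bendN; lia. Qed.

(** Up to the first nonzero mirror difference the bends equal [step]; from 1 or -1 the bounds let
    them move only inwards. *)
Lemma bend_balanced (r : nat -> nat) :
  (forall i j, (j <= i)%N -> -1 <= bend (psum r) i j <= 1) -> markoff_balanced r.
Proof.
move=> b; split=> i i0; first by have := b i 1%N i0; rewrite stepE; lia.
rewrite stepE //.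
have key j : first_nonzero r i j -> bend (psum r) i j = bend (psum r) i 1%N.
  move=> [ij _ md0].
  suff : forall k, (0 < k <= j)%N -> bend (psum r) i k = bend (psum r) i 1%N.
    by apply; lia.
  elim=> [//|[//|k] IH] kj.
  by have := md0 k.+1 ltac:(lia); rewrite mirror_diffE; have := IH ltac:(lia); lia.
by split=> st j fj; have := key j fj; case: fj => ij; rewrite mirror_diffE;
  have := b i j.+1 ltac:(lia); lia.
Qed.

Lemma bend_increase (S : nat -> int) (i k : nat) :
  bend S i 1 = -1 -> (0 < k)%N ->
  (exists2 j, (0 < j < k)%N & bend S i j < bend S i j.+1) \/ bend S i k <= -1.
Proof.
move=> b1; elim: k => [//|[|k] IH] _; first by right; lia.
have [[j jk jb]|bk] := IH isT; first by left; exists j => //; lia.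
have [lt|le] := ltP (bend S i k.+1) (bend S i k.+2); last by right; lia.
by left; exists k.+1 => //; lia.
Qed.

(** The bend S (i + i) - 2 S i at [j = i] is nonnegative, so the bends cannot stay at or below -1.
    The increase is the index required by (C). *)
Lemma sandwich_increase (S : nat -> int) (i : nat) :
  S 0%N = 0 -> sandwich S -> (0 < i)%N -> bend S i 1 = -1 ->
  exists2 j, (0 < j < i)%N & bend S i j < bend S i j.+1.
Proof.
move=> S0 sw i0 b1; have [//|] := bend_increase b1 i0.
by have := sw i i; rewrite /bend subnn S0; lia.
Qed.

Lemma M01P (r : nat -> nat) : M01 r <-> sandwich (psum r).
Proof.
split=> [[bal r12 C]|sw].
  apply: mirrored_sandwich; [exact: psum0|exact: balanced_mirrored|].
  move=> i i0 b; have [|j [ij]] := C i i0.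
    by rewrite stepE // b //; lia.
  have := @mirror_diffE r i j ltac:(lia); rewrite /mirror_diff.
  by rewrite (b j) ?(b j.+1); lia.
split; first by apply: bend_balanced => i j; apply: sandwich_bend.
  have := sw 1%N 1%N; have := psum0 r; have := psumS r 0; have := psumS r 1.
  by rewrite addn1; lia.
move=> i i0; rewrite stepE // => st.
have [j ij jb] := sandwich_increase (psum0 r) sw i0 st.
exists j; split=> //.
by have := @mirror_diffE r i j ltac:(lia); rewrite /mirror_diff; lia.
Qed.

Lemma M10P (t : nat -> nat) : M10 t <-> sandwich (fun n => - psum t n).
Proof.
have t0 : - psum t 0 = 0 by rewrite psum0.
split=> [[bal t12 C]|sw].
  apply: mirrored_sandwich => //; first exact/mirroredN/balanced_mirrored.
  move=> i i0 b; have {}b j : (0 < j <= i)%N -> bend (psum t) i j = 1.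
    by move=> /b; rewrite bendN; lia.
  have [|j [ij]] := C i i0; first by rewrite stepE // b //; lia.
  have := @mirror_diffE t i j ltac:(lia); rewrite /mirror_diff.
  by rewrite (b j) ?(b j.+1); lia.
split; first by apply: bend_balanced => i j; apply: sandwichN_bend.
  have := sw 1%N 1%N; have := psum0 t; have := psumS t 0; have := psumS t 1.
  by rewrite addn1; lia.
move=> i i0; rewrite stepE // => st.
have [|j ij] := sandwich_increase t0 sw i0; first by rewrite bendN st.
rewrite !bendN => jb; exists j; split=> //.
by have := @mirror_diffE t i j ltac:(lia); rewrite /mirror_diff; lia.
Qed.

(** * Slope of an eventually periodic sequence *)

Definition slope_bounds (P : int) (p : nat) (S : nat -> int) : Prop :=
  forall n : nat, p%:Z * S n <= n%:Z * P <= p%:Z * (S n + 1).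

(** Joining m blocks takes m - 1 joints, each adding at most 1; hence the strict bound. *)
Lemma sandwich_mul (S : nat -> int) (m n : nat) :
  sandwich S -> (0 < m)%N ->
  m%:Z * S n <= S (m * n)%N < m%:Z * S n + m%:Z.
Proof.
move=> sw; elim: m => [//|[|m] IH] _; first by rewrite mul1n; lia.
have := sw n (m.+1 * n)%N; have := IH isT.
by rewrite -mulSn -(addn1 m.+1) PoszD mulrDl mul1r; lia.
Qed.

(** Far out, a window of length n p sums to n P; compare it with S (n p), and that with p copies of
    S n. *)
Lemma sandwich_slope (S : nat -> int) (P : int) (p N : nat) :
  sandwich S -> (0 < p)%N ->
  (forall i, (N <= i)%N -> S (i + p)%N = S i + P) -> slope_bounds P p S.
Proof.
move=> sw p0 per n.
have perM m : S (N + m * p)%N = S N + m%:Z * P.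
  elim: m => [|m IH]; first by rewrite addn0; lia.
  have -> : (N + m.+1 * p = N + m * p + p)%N by lia.
  by rewrite per ?IH; lia.
have := sw N (n * p)%N; rewrite perM mulnC.
by have := sandwich_mul n sw p0; lia.
Qed.

(** * The two staircases of a given slope *)

(* Floor of (n * P - b) / p, except at n = 0, where the partial sum is empty. *)
Definition staircase (P : int) (p : nat) (b : bool) (n : nat) : int :=
  if n is 0%N then 0 else ((n%:Z * P - b%:Z) %/ p%:Z)%Z.

Lemma pmul_gtN_ge0 (p : nat) (y : int) : - p%:Z < p%:Z * y -> 0 <= y.
Proof. by nia. Qed.

Section Staircase.

Variables (P : int) (p : nat).
Hypothesis p0 : (0 < p)%N.

Lemma staircaseP (b : bool) (n : nat) : (0 < n)%N ->
  p%:Z * staircase P p b n <= n%:Z * P - b%:Z < p%:Z * staircase P p b n + p%:Z.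
Proof.
case: n => // n _; rewrite /staircase.
have := divz_eq (n.+1%:Z * P - b%:Z) p%:Z.
have := modz_ge0 (n.+1%:Z * P - b%:Z) (d := p%:Z) ltac:(lia).
have := ltz_pmod (n.+1%:Z * P - b%:Z) (d := p%:Z) ltac:(lia).
by set q := divz _ _; set m := modz _ _; lia.
Qed.

Lemma staircase_uniq (b : bool) (n : nat) (y : int) : (0 < n)%N ->
  p%:Z * y <= n%:Z * P - b%:Z < p%:Z * y + p%:Z -> y = staircase P p b n.
Proof.
by move=> /(staircaseP b); set v := staircase _ _ _ _ => h1 h2; nia.
Qed.

Lemma staircase_sandwich (b : bool) : sandwich (staircase P p b).
Proof.
move=> i n; have [->|i0] := posnP i; first by rewrite add0n /=; lia.
have [->|n0] := posnP n; first by rewrite addn0 /=; lia.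
have := staircaseP b (ltn_addr n i0).
have := staircaseP b i0; have := staircaseP b n0.
set u := staircase _ _ _ i; set v := staircase _ _ _ n; set w := staircase _ _ _ _.
move=> hv hu hw; have := @pmul_gtN_ge0 p (w - u - v); have := @pmul_gtN_ge0 p (u + v + 1 - w).
by case: b u v w hu hv hw => u v w /=; lia.
Qed.

Lemma staircase_at_period (b : bool) : staircase P p b p = P - b%:Z.
Proof. by symmetry; apply: staircase_uniq => //; case: b; nia. Qed.

Lemma staircase_dichotomy (S : nat -> int) :
  coprimez P p%:Z -> S 0%N = 0 -> sandwich S -> slope_bounds P p S ->
  exists b, S =1 staircase P p b.
Proof.
move=> cop S0 sw sb.
(* [S p] is P or P - 1. The lower bound of [sandwich_mul] settles the first case, its strict upper
   bound the second. *)
have mul k : S (k.+1 * p)%N = k.+1%:Z * P - (S p != P)%:Z.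
  have := sb (k.+1 * p)%N; have := sandwich_mul p sw (ltn0Sn k); have := sb p.
  by case: eqP => [->|]; nia.
exists (S p != P) => -[|n]; first by [].
apply: staircase_uniq => //; have := sb n.+1.
have [/dvdzP [k nk]|ndiv] := boolP (p%:Z %| n.+1%:Z * P)%Z.
  have : (p %| n.+1)%N.
    have : (p%:Z %| n.+1%:Z * P)%Z by apply/dvdzP; exists k.
    by rewrite Gauss_dvdzl // coprimez_sym.
  case/dvdnP => -[|m] nm; first by lia.
  by rewrite nm mul; case: eqP; nia.
have sep y : n.+1%:Z * P <> p%:Z * y.
  by move=> e; move/negP: ndiv; apply; apply/dvdzP; exists y; rewrite e mulrC.
have := sep (S n.+1); have := sep (S n.+1 + 1).
by case: eqP => _ /=; lia.
Qed.

Lemma staircase_shift : coprimez P p%:Z ->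
  exists (c : int) (k : nat), forall i : nat, (0 < i)%N ->
    staircase P p false (k + i) = staircase P p true i + c.
Proof.
move=> cop; have [u [v uv]] := Bezoutz P p%:Z.
have {}uv : u * P + v * p%:Z = 1 by rewrite uv; exact/eqP.
have m0 := modz_ge0 (- u) (d := p%:Z) ltac:(lia).
have := divz_eq (- u) p%:Z; set q := divz _ _ => du.
(* A residue of -u is a natural number k with k P congruent to -1 modulo p, so a shift by k replaces
   the numerator i P by i P - 1 up to p c. *)
pose k := `|(- u %% p%:Z)%Z|%N; pose c := v - q * P.
have kP : k%:Z * P = p%:Z * c - 1.
  have -> : k%:Z = - u - q * p%:Z by rewrite {1}du /k; lia.
  by rewrite /c; lia.
exists c, k => i i0; have := staircaseP false (ltn_addl k i0).
set w := staircase _ _ _ (k + i) => hw.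
rewrite -(@staircase_uniq true i (w - c) i0); first by lia.
by move: hw; rewrite PoszD; lia.
Qed.

End Staircase.

(** * Lowest terms, periods and shifts *)

Lemma slope_bounds_reduced (P : int) (p : nat) : (0 < p)%N ->
  exists (P' : int) (p' : nat), [/\ (0 < p')%N, coprimez P' p'%:Z &
    forall S, slope_bounds P p S -> slope_bounds P' p' S].
Proof.
move=> p0; pose g := gcdn `|P| p.
have g0 : (0 < g)%N by rewrite gcdn_gt0 p0 orbT.
have [P' gP] : exists P', P = P' * g%:Z.
  by apply/dvdzP; rewrite dvdzE dvdn_gcdl.
have /dvdnP[p' gp] : (g %| p)%N := dvdn_gcdr _ _.
exists P', p'; split; first by lia.
  rewrite /coprimez; apply/eqP; suff : gcdn `|P'| p' = 1%N by rewrite /gcdz => ->.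
  have : (gcdn `|P'| p' * g = 1 * g)%N by rewrite muln_gcdl -gp mul1n {2}/g gP abszM.
  by move/eqP; rewrite eqn_pmul2r // => /eqP.
move=> S sb n; have := sb n; rewrite gP gp PoszM.
have gz : 0 < g%:Z by lia.
rewrite ![_ * g%:Z]mulrC -!mulrA [n%:Z * _]mulrCA.
by rewrite !(ler_pM2l gz).
Qed.

Lemma psum_inj (r s : nat -> nat) :
  psum r =1 psum s -> seq_eq r s.
Proof. by move=> e [//|i] _; have := e i.+1; rewrite !psumS e; lia. Qed.

Lemma psum_periodic (r : nat -> nat) (p N : nat) :
  (forall i, (N < i)%N -> r (i + p)%N = r i) ->
  exists P, forall i, (N <= i)%N -> psum r (i + p)%N = psum r i + P.
Proof.
move=> per; exists (psum r (N + p)%N - psum r N) => i /subnKC <-.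
elim: (i - N)%N => [|m IH]; first by rewrite addn0; lia.
by rewrite addnS addSn !psumS IH -addSn per; lia.
Qed.

Lemma psum_shift (r s : nat -> nat) (k l : nat) :
  (forall i, (1 <= i)%N -> s (k + i)%N = r (l + i)%N) ->
  exists c, forall i, psum s (k + i)%N = psum r (l + i)%N + c.
Proof.
move=> e; exists (psum s k - psum r l).
elim=> [|i IH]; first by rewrite !addn0; lia.
by rewrite !addnS !psumS IH -!addnS e //; lia.
Qed.

Lemma shift_psum (r s : nat -> nat) (c : int) (k l : nat) :
  (forall i, psum s (k + i)%N = psum r (l + i)%N + c) -> equivalent s r.
Proof.
move=> e; exists k, l => -[//|i] _; have := e i.+1.
by rewrite !addnS !psumS e; lia.
Qed.

Lemma equivalent_psum_periodic (r s : nat -> nat) (p N : nat) (P : int) :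
  (forall i, (N <= i)%N -> psum r (i + p)%N = psum r i + P) -> equivalent s r ->
  exists N', forall i, (N' <= i)%N -> psum s (i + p)%N = psum s i + P.
Proof.
move=> per [k [l /psum_shift [c e]]]; exists (k + N)%N => i iN.
have -> : (i = k + (i - k))%N by lia.
by rewrite -addnA !e addnA per; lia.
Qed.

Lemma equivalent_sym (r s : nat -> nat) : equivalent r s -> equivalent s r.
Proof. by move=> [k [l e]]; exists l, k => i /e. Qed.

(** * The second sequence, for both signs at once *)

Section OneMore.

Variables (M : (nat -> nat) -> Prop) (sg : int).
Hypothesis sg1 : sg = 1 \/ sg = -1.
Hypothesis MP : forall r, M r <-> sandwich (fun n => sg * psum r n).

(* The monotonicity hypothesis makes the terms of the second sequence
   nonnegative; it is what excludes the zero sequence from the M01 case. *)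
Lemma exactly_one_more_staircase (r : nat -> nat) :
  (forall P p b, (0 < p)%N -> slope_bounds P p (fun n => sg * psum r n) ->
    forall n, 0 <= sg * (staircase P p b n.+1 - staircase P p b n)) ->
  M r -> periodic r -> exactly_one_more M r.
Proof.
move=> mono Mr [p0 [N [p0_gt0 /psum_periodic [P0 per]]]].
have [P [p [p_gt0 cop red]]] := slope_bounds_reduced (sg * P0) p0_gt0.
have slope s : M s -> equivalent s r -> slope_bounds P p (fun n => sg * psum s n).
  move=> /MP sw /(equivalent_psum_periodic per) [N' per'].
  apply/red/(@sandwich_slope _ _ _ N') => // i /per' ->.
  by rewrite mulrDr.
have stair s : M s -> equivalent s r ->
    exists b, (fun n => sg * psum s n) =1 staircase P p b.
  move=> Ms es; apply: staircase_dichotomy => //; last exact: slope.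
    by rewrite psum0 mulr0.
  exact/MP.
have sbr : slope_bounds P p (fun n => sg * psum r n).
  by apply: slope => //; exists 0%N, 0%N.
have [b rb] := stair r Mr ltac:(by exists 0%N, 0%N).
have sgE (r1 r2 : nat -> nat) : (fun n => sg * psum r1 n) =1 (fun n => sg * psum r2 n) ->
    seq_eq r1 r2.
  by move=> e; apply: psum_inj => n; have := e n; case: sg1 => ->; lia.
pose s i := `|staircase P p (~~ b) i - staircase P p (~~ b) i.-1|%N.
have sb n : sg * psum s n = staircase P p (~~ b) n.
  elim: n => [|n IH]; first by rewrite psum0 mulr0.
  rewrite psumS mulrDr IH /s; have := mono P p (~~ b) p_gt0 sbr n.
  by rewrite [n.+1.-1]/=; move: (staircase _ _ _ n.+1) (staircase _ _ _ n) => u v;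
    case: sg1 => ->; lia.
have diff r1 r2 c : (fun n => sg * psum r1 n) =1 staircase P p c ->
    (fun n => sg * psum r2 n) =1 staircase P p (~~ c) -> ~ seq_eq r1 r2.
  move=> e1 e2 e; have := e1 p; have := e2 p.
  have -> : psum r2 p = psum r1 p.
    by congr Posz; apply: eq_bigr => i _; rewrite e.
  by move=> ->; rewrite !staircase_at_period //; case: c {e1 e2}; lia.
have equiv r1 r2 : (fun n => sg * psum r1 n) =1 staircase P p false ->
    (fun n => sg * psum r2 n) =1 staircase P p true -> equivalent r1 r2.
  move=> e1 e2; have [c [k ek]] := staircase_shift p_gt0 cop.
  (* The extra 1 in both shifts avoids index 0, where [staircase_shift] says nothing. *)
  apply: (@shift_psum _ _ (sg * c) (k + 1) 1) => i.
  have := e1 (k + 1 + i)%N; have := e2 (1 + i)%N.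
  by rewrite -addnA ek //; case: sg1 => ->; lia.
exists s; split.
- apply/MP => i n; rewrite !sb; exact: staircase_sandwich.
- by move=> e; apply: (diff s r (~~ b)) => // n; rewrite negbK.
- by case bE: b; [|apply: equivalent_sym]; apply: equiv => n; rewrite ?rb ?sb bE.
- move=> s' Ms' ne es'; have [b' eb'] := stair s' Ms' es'.
  have bb : b' != b.
    by apply/eqP => bb; apply: ne; apply: sgE => m; rewrite eb' rb bb.
  have {}bb : b' = ~~ b by move: bb; clear; case: b b' => -[].
  by apply: sgE => n; rewrite eb' sb bb.
Qed.

End OneMore.

Theorem theorem4p3 :
  (forall r : nat -> nat,
     M01 r -> periodic r -> ~ seq_eq r (fun _ => 0%N) ->
     exactly_one_more M01 r) /\
  (forall t : nat -> nat,
     M10 t -> periodic t -> exactly_one_more M10 t).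
Proof.
split=> [r Mr per r0|t Mt per].
  apply: (@exactly_one_more_staircase M01 1) => //; first by left.
    by move=> s; rewrite M01P; split=> sw i n; have := sw i n; lia.
  move=> P p b p0 sb n.
  (* If P <= 0, the nonnegative partial sums all vanish. P >= 1 keeps the first value of the
     staircase nonnegative even for [b = true]. *)
  have P0 : 0 < P.
    rewrite ltNge; apply/negP => P0; apply: r0 => -[//|i] _.
    have := sb i.+1; rewrite psumS /psum; nia.
  have := staircaseP P p0 b (ltn0Sn n).
  have [->|n0] := posnP n; first by rewrite /=; case: b; nia.
  have := staircaseP P p0 b n0; nia.
apply: (@exactly_one_more_staircase M10 (-1)) => //; first by right.
  by move=> s; rewrite M10P; split=> sw i n; have := sw i n; lia.
move=> P p b p0 sb n.
have P0 : P <= 0.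
  (* The bound reads (p + 1) P <= p; taking n = p would still allow P = 1. *)
  have := sb p.+1; rewrite /psum; nia.
have := staircaseP P p0 b (ltn0Sn n).
have [->|n0] := posnP n; first by rewrite /=; case: b; nia.
have := staircaseP P p0 b n0; nia.
Qed.
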